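(* Let $\mathfrak{X}=\langle X,\tau^0,\tau^1\rangle$ be the ultrabouquet built from $\{\langle X_n,\tau^0_n,\tau^1_n\rangle\}_{n\in\mathbb{N}}$ as described in the context. If an $\mathcal{L}(\Box,\rhd)$-formula $\varphi$ is valid in every $\langle X_n,\tau^0_n,\tau^1_n\rangle$, then $\varphi$ is also valid in $\mathfrak{X}$.
   Context: $\mathcal{L}(\Box,\rhd)$ has propositional variables, $\top,\bot$, $\neg,\land,\lor,\to$, unary $\Box,\Diamond$, binary $\rhd$. For a topology $\tau$ on $X$, $d_\tau(Y)=\{x: \text{every } U\in\tau \text{ containing } x \text{ meets } Y\setminus\{x\}\}$, $cd_\tau(Y)=X\setminus d_\tau(X\setminus Y)$; $\langle X,\tau\rangle$ is scattered if $Y\setminus d_\tau(Y)\neq\varnothing$ for every nonempty $Y$. A bitopological space is $\langle X,\tau^0,\tau^1\rangle$ with $X\ne\varnothing$ and $\tau^0,\tau^1$ topologies; $e_{\tau^0,\tau^1}(Y,Z)=\{x:\forall U\in\tau^1[x\in d_{\tau^0}(Y\cap U)\Rightarrow x\in d_{\tau^0}(Z\cap U)]\}$; a valuation $v$ maps formulas to subsets of $X$, Boolean on connectives, with $v(\Box\varphi)=cd_{\tau^0}(v(\varphi))$, $v(\Diamond\varphi)=d_{\tau^0}(v(\varphi))$, $v(\varphi\rhd\psi)=e_{\tau^0,\tau^1}(v(\varphi),v(\psi))$; $\varphi$ is valid in the space if $v(\varphi)=X$ for every valuation $v$. Ultrabouquet: $\{\langle X_n,\tau^0_n,\tau^1_n\rangle\}_{n\in\mathbb{N}}$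 are bitopological spaces with each $\langle X_n,\tau^0_n\rangle$ scattered and the $X_n$ pairwise disjoint; $x_n\in X_n$; $Y_n\subseteq X_n$ with $x_n\in Y_n\in\tau^0_n$ and $Y_n\setminus\{x_n\}\in\tau^0_n$; $\mathcal{U}$ a non-principal ultrafilter on $\mathbb{N}$; $x_\ast\notin\bigcup_nX_n$ a new point. $X=\bigcup_n(X_n\setminus\{x_n\})\cup\{x_\ast\}$. For $V\subseteq X$, $V\restriction X_n=V\cap X_n$ if $x_\ast\notin V$, and $((V\setminus\{x_\ast\})\cup\{x_n\})\cap X_n$ if $x_\ast\in V$; $V\restriction Y_n$ likewise with $Y_n$. $U\in\tau^0$ iff (i) $U\cap(Y_n\setminus\{x_n\})\in\tau^0_n$ for all $n$ and (ii) if $x_\ast\in U$ then $\{n:U\restriction Y_n\in\tau^0_n\}\in\mathcal{U}$; $U\in\tau^1$ iff $U\restriction X_n\in\tau^1_n$ for all $n$. $\mathfrak{X}=\langle X,\tau^0,\tau^1\rangle$ is a bitopological space. *)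

(* Defs.v *)
From mathcomp Require Import all_boot.
From mathcomp Require Import boolp classical_sets filter.

Set Implicit Arguments.
Unset Strict Implicit.
Unset Printing Implicit Defensive.

Local Open Scope classical_set_scope.

Inductive formula : Type :=
| Var of nat
| Top
| Bot
| Neg of formula
| And of formula & formula
| Or of formula & formula
| Imp of formula & formula
| Box of formula
| Dia of formula
| Rhd of formula & formula.

(* All spaces live on subsets of an ambient type [T]: a topology on the set
   [X : set T] is the family of its open sets, all of them subsets of [X]. *)
Record is_topology (T : Type) (X : set T) (tau : set (set T)) : Prop :=
  IsTopology {
    top_sub : forall U, tau U -> U `<=` X ;
    top_set0 : tau set0 ;
    top_setT : tau X ;
    top_setI : forall U V, tau U -> tau V -> tau (U `&` V) ;
    top_bigcup : forall F : set (set T), F `<=` tau -> tau (\bigcup_(U in F) U)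
  }.

Definition derived (T : Type) (X : set T) (tau : set (set T)) (Y : set T) :
    set T :=
  [set x | X x /\ forall U, tau U -> U x -> U `&` (Y `\ x) !=set0].

Definition coderived (T : Type) (X : set T) (tau : set (set T)) (Y : set T) :
    set T :=
  X `\` derived X tau (X `\` Y).

Definition scattered (T : Type) (X : set T) (tau : set (set T)) : Prop :=
  forall Y : set T, Y `<=` X -> Y !=set0 -> Y `\` derived X tau Y !=set0.

Record bispace (T : Type) : Type := Bispace {
  carrier : set T ;
  tau0 : set (set T) ;
  tau1 : set (set T)
}.

Record is_bitopological (T : Type) (S : bispace T) : Prop := IsBitopological {
  bitop_nonempty : carrier S !=set0 ;
  bitop_tau0 : is_topology (carrier S) (tau0 S) ;
  bitop_tau1 : is_topology (carrier S) (tau1 S)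
}.

Definition rhd_op (T : Type) (S : bispace T) (Y Z : set T) : set T :=
  [set x | carrier S x /\
     forall U, tau1 S U ->
       derived (carrier S) (tau0 S) (Y `&` U) x ->
       derived (carrier S) (tau0 S) (Z `&` U) x].

Record is_valuation (T : Type) (S : bispace T) (v : formula -> set T) : Prop :=
  IsValuation {
    val_sub : forall f, v f `<=` carrier S ;
    val_top : v Top = carrier S ;
    val_bot : v Bot = set0 ;
    val_neg : forall f, v (Neg f) = carrier S `\` v f ;
    val_and : forall f g, v (And f g) = v f `&` v g ;
    val_or : forall f g, v (Or f g) = v f `|` v g ;
    val_imp : forall f g, v (Imp f g) = (carrier S `\` v f) `|` v g ;
    val_box : forall f, v (Box f) = coderived (carrier S) (tau0 S) (v f) ;
    val_dia : forall f, v (Dia f) = derived (carrier S) (tau0 S) (v f) ;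
    val_rhd : forall f g, v (Rhd f g) = rhd_op S (v f) (v g)
  }.

Definition valid (T : Type) (S : bispace T) (f : formula) : Prop :=
  forall v, is_valuation S v -> v f = carrier S.

Definition nonprincipal_ultrafilter (I : Type) (F : set (set I)) : Prop :=
  UltraFilter F /\ forall i : I, F <> principal_filter i.

(* [V] restricted to [A], with the new point [xs] read as the old point [xn]. *)
Definition restr (T : Type) (xs xn : T) (V A : set T) : set T :=
  if `[< V xs >] then ((V `\ xs) `|` [set xn]) `&` A else V `&` A.

Definition ultrabouquet (T : Type) (S : nat -> bispace T) (x : nat -> T)
    (Y : nat -> set T) (F : set (set nat)) (xs : T) : bispace T :=
  let X := (\bigcup_n (carrier (S n) `\ x n)) `|` [set xs] in
  {| carrier := X ;
     tau0 := [set U | [/\ U `<=` X,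
       forall n, tau0 (S n) (U `&` (Y n `\ x n)) &
       U xs -> F [set n | tau0 (S n) (restr xs (x n) U (Y n))]]] ;
     tau1 := [set U | U `<=` X /\
       forall n, tau1 (S n) (restr xs (x n) U (carrier (S n)))] |}.

(* Main.v *)
Require Import Defs.
From mathcomp Require Import all_boot.
From mathcomp Require Import boolp classical_sets filter.

(** The heart of the proof is a Łoś-type theorem. Given a valuation on the
    ultrabouquet, give each [S n] the restricted valuation, [x n] inheriting the
    values of [xs]. Then [xs] satisfies a formula iff [x n] satisfies it for
    [F]-almost all [n], and the points of [Y n `\ x n] satisfy the same formulas
    as before, because [Y n `\ x n] is open on both sides and carries the same
    [tau0]. The remaining points, those of [carrier (S n)] outside [Y n], are
    isolated in the ultrabouquet, so there only the values of the variables
    matter; scatteredness supplies an isolated point of [S n] at which these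
    values can be reproduced. *)

Local Open Scope classical_set_scope.

Lemma derived_mono {T : Type} {X : set T} {tau : set (set T)} {A B : set T} :
  A `<=` B -> derived X tau A `<=` derived X tau B.
Proof.
move=> AB z [Xz dA]; split=> // U tU Uz.
by have [w [Uw [Aw wz]]] := dA U tU Uz; exists w; split=> //; split=> //; exact: AB.
Qed.

(** * The valuation generated by an assignment to the variables *)

Section Evaluation.
Context {T : Type} (S : bispace T) (p : nat -> set T).

(** Cutting [p i] down to the carrier allows an arbitrary assignment [p], even one with values
    reaching outside the space. *)
Fixpoint eval (f : formula) : set T :=
  match f with
  | Var i => p i `&` carrier S
  | Top => carrier S
  | Bot => set0
  | Neg f => carrier S `\` eval f
  | And f g => eval f `&` eval g
  | Or f g => eval f `|` eval g
  | Imp f g => (carrier S `\` eval f) `|` eval g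
  | Box f => coderived (carrier S) (tau0 S) (eval f)
  | Dia f => derived (carrier S) (tau0 S) (eval f)
  | Rhd f g => rhd_op S (eval f) (eval g)
  end.

Lemma eval_valuation : is_valuation S eval.
Proof.
split=> //; elim=> //=.
- by move=> f fS g _ z [/fS].
- by move=> f fS g gS z [/fS|/gS].
- by move=> f fS g gS z [[]|/gS].
- by move=> f _ z [].
- by move=> f _ z [].
- by move=> f _ g _ z [].
Qed.

End Evaluation.

(** * Truth at isolated points *)

Definition isolated {T : Type} (S : bispace T) (z : T) : Prop :=
  carrier S z /\ ~ derived (carrier S) (tau0 S) (carrier S) z.

(** An isolated point belongs to no derived set, so there [Dia] is false while [Box] and [Rhd] hold
    vacuously; what remains is Boolean in the variables. *)
Lemma isolated_equiv {T : Type} {S S' : bispace T} {v v' : formula -> set T}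
    {z z' : T} :
  is_valuation S v -> is_valuation S' v' -> isolated S z -> isolated S' z' ->
  (forall i, v (Var i) z <-> v' (Var i) z') ->
  forall f, v f z <-> v' f z'.
Proof.
move=> vS vS' [Sz Nz] [Sz' Nz'] vv'.
have nd A : A `<=` carrier S -> ~ derived (carrier S) (tau0 S) A z.
  by move=> /derived_mono AS /AS.
have nd' A : A `<=` carrier S' -> ~ derived (carrier S') (tau0 S') A z'.
  by move=> /derived_mono AS /AS.
elim=> [//|||f IH|f IHf g IHg|f IHf g IHg|f IHf g IHg|f _|f _|f _ g _].
- by rewrite (val_top vS) (val_top vS').
- by rewrite (val_bot vS) (val_bot vS').
- by rewrite (val_neg vS) (val_neg vS') /=; tauto.
- by rewrite (val_and vS) (val_and vS') /=; tauto.
- by rewrite (val_or vS) (val_or vS') /=; tauto.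
- by rewrite (val_imp vS) (val_imp vS') /=; tauto.
- rewrite (val_box vS) (val_box vS'); split=> _; split=> //.
    by apply: nd' => w [].
  by apply: nd => w [].
- rewrite (val_dia vS) (val_dia vS').
  by split=> [/nd|/nd'] []; exact: val_sub.
- rewrite (val_rhd vS) (val_rhd vS'); split=> _; split=> // U _.
    by move=> /nd' []; move=> w [/(val_sub vS')].
  by move=> /nd []; move=> w [/(val_sub vS)].
Qed.

Lemma valid_isolated {T : Type} {S S' : bispace T} {phi : formula}
    {v : formula -> set T} {y z : T} :
  isolated S y -> valid S phi ->
  is_valuation S' v -> isolated S' z -> v phi z.
Proof.
move=> yS phiS vS' zS'.
(* Every variable is made full or empty on [S] according to its truth value at [z], so [y] and [z]
   satisfy the same variables. *)
have vS := eval_valuation S (fun i => [set _ | v (Var i) z]).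
have vv i : eval S (fun i => [set _ | v (Var i) z]) (Var i) y <-> v (Var i) z.
  by case: (yS) => Sy _ /=; tauto.
apply/(isolated_equiv vS vS' yS zS' vv).
by rewrite (phiS _ vS); case: yS.
Qed.

Lemma scattered_isolated {T : Type} {S : bispace T} :
  carrier S !=set0 -> scattered (carrier S) (tau0 S) -> exists y, isolated S y.
Proof. by move=> S0 /(_ _ (fun _ h => h) S0)[y []]; exists y. Qed.

(** * Boolean behaviour of membership in an ultrafilter *)

Section UltraMembership.
Context {I : Type} {F : set (set I)} {FU : UltraFilter F}.

Lemma ultra_setI (A B : set I) : F (A `&` B) <-> F A /\ F B.
Proof.
split=> [AB|[]]; last exact: filterI.
by split; apply: filterS AB => i [].
Qed.

Lemma ultra_setC (A : set I) : F (~` A) <-> ~ F A.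
Proof.
split=> [nA FA|nA]; last by case: (in_ultra_setVsetC A FU).
by have [i []] := filter_ex (filterI FA nA).
Qed.

End UltraMembership.

(** * Points of the ultrabouquet and restriction to the summands *)

Section Ultrabouquet.
Context {T : Type} {S : nat -> bispace T} {x : nat -> T} {Y : nat -> set T}
  {F : set (set nat)} {xs : T}.
Hypotheses (S_bitop : forall n, is_bitopological (S n))
  (S_disjoint : trivIset setT (fun n => carrier (S n)))
  (x_in : forall n, carrier (S n) (x n))
  (Y_sub : forall n, Y n `<=` carrier (S n))
  (xY : forall n, Y n (x n))
  (Y_open : forall n, tau0 (S n) (Y n))
  (Yx_open : forall n, tau0 (S n) (Y n `\ x n))
  (FU : UltraFilter F)
  (xs_new : ~ (\bigcup_n carrier (S n)) xs).

Local Notation B := (ultrabouquet S x Y F xs).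
Local Notation dB := (derived (carrier B) (tau0 B)).
Local Notation d n := (derived (carrier (S n)) (tau0 (S n))).

Lemma index_inj {m n : nat} {z : T} :
  carrier (S m) z -> carrier (S n) z -> m = n.
Proof. by move=> mz nz; apply: (S_disjoint m n) => //; exists z. Qed.

Lemma carrier_neq_xs {n : nat} {z : T} : carrier (S n) z -> z <> xs.
Proof. by move=> nz zxs; apply: xs_new; exists n => //; rewrite -zxs. Qed.

Lemma carrier_bouquet {n : nat} {z : T} :
  carrier (S n) z -> z <> x n -> carrier B z.
Proof. by move=> nz zx; left; exists n. Qed.

Lemma restr_off {n : nat} {U A : set T} {z : T} :
  A `<=` carrier (S n) -> A z -> z <> x n ->
  restr xs (x n) U A z <-> U z.
Proof.
move=> AS Az zx; have zxs := carrier_neq_xs (AS _ Az).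
by rewrite /restr; case: asboolP => _ /=; tauto.
Qed.

(** By disjointness [x n] lies in no other summand, so it is not a point of the ultrabouquet and can
    enter the restriction only as the image of [xs]. *)
Lemma restr_at {n : nat} {U A : set T} :
  A `<=` carrier (S n) -> A (x n) -> U `<=` carrier B ->
  restr xs (x n) U A (x n) <-> U xs.
Proof.
move=> AS Ax UB; rewrite /restr; case: asboolP => Uxs /=; first by tauto.
split=> // -[/UB [[m _ [mx nx]]|/= /(carrier_neq_xs (x_in n))//] _].
by case: nx; rewrite (index_inj mx (x_in n)).
Qed.

Lemma restr_eq {n : nat} {U A V : set T} :
  A `<=` carrier (S n) -> A (x n) -> U `<=` carrier B -> V `<=` A ->
  (U xs <-> V (x n)) ->
  (forall z, A z -> z <> x n -> (U z <-> V z)) ->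
  restr xs (x n) U A = V.
Proof.
move=> AS Ax UB VA xsV UV; apply/seteqP; split=> z.
- move=> rz; have Az : A z by move: rz; rewrite /restr; case: ifP => _ [].
  have [zx|zx] := pselect (z = x n).
    by move: rz; rewrite zx; move/(restr_at AS Ax UB)/xsV.
  by apply/(UV _ Az zx)/(restr_off AS Az zx).
- move=> Vz; have Az := VA _ Vz; have [zx|zx] := pselect (z = x n).
    by rewrite zx in Vz *; apply/(restr_at AS Ax UB)/xsV.
  by apply/(restr_off AS Az zx)/(UV _ Az zx).
Qed.

(** * The Łoś correspondence and its preservation by derived sets *)

Definition agree (A : set T) (An : nat -> set T) : Prop :=
  forall n z, Y n z -> z <> x n -> (A z <-> An n z).

(** The two clauses are kept apart because the modal operators, at [xs] as well, depend only on
    [agree] for their arguments: a derived set ignores whether the point itself belongs to the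
    set. *)
Definition los (A : set T) (An : nat -> set T) : Prop :=
  agree A An /\ (A xs <-> F [set n | An n (x n)]).

(** The traces on the other summands are empty by disjointness, and the ultrafilter clause is
    vacuous since [xs] is not a member. This carries neighbourhoods from [S n] to the
    ultrabouquet. *)
Lemma bouquet_tau0_local {n : nat} {U : set T} :
  tau0 (S n) U -> tau0 B (U `&` (Y n `\ x n)).
Proof.
move=> tU; split=> [z [_ [/Y_sub nz zx]]|m|[_ [/Y_sub/carrier_neq_xs]]] //.
  exact: (carrier_bouquet nz).
have [->|mn] := pselect (m = n).
  by rewrite -setIA setIid; apply: (top_setI (bitop_tau0 (S_bitop n))).
rewrite (_ : _ `&` _ = set0); first by exact: top_set0 (bitop_tau0 (S_bitop m)).
apply/seteqP; split=> // z [[_ [/Y_sub nz _]] [/Y_sub mz _]].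
by apply: mn; exact: index_inj mz nz.
Qed.

(** Neighbourhoods of [z] in either space can be shrunk to [Y n] minus [x n], where they are open in
    the other space too. *)
Lemma derived_agree {A : set T} {An : nat -> set T} :
  agree A An -> agree (dB A) (fun n => d n (An n)).
Proof.
move=> AAn n z Yz zx; split=> -[_ dA].
- split=> [|U tU Uz]; first exact: Y_sub.
  have [w [[Uw [Yw wx]] [Aw wz]]] := dA _ (bouquet_tau0_local tU) (conj Uz (conj Yz zx)).
  by exists w; split=> //; split=> //; exact/(AAn n w Yw wx).
- split=> [|U [UB tU _] Uz]; first exact: carrier_bouquet (Y_sub _ _ Yz) zx.
  have [w [[Uw [Yw wx]] [Aw wz]]] := dA _ (tU n) (conj Uz (conj Yz zx)).
  by exists w; split=> //; split=> //; exact/(AAn n w Yw wx).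
Qed.

Lemma derived_xs {A : set T} {An : nat -> set T} :
  agree A An -> dB A xs <-> F [set n | d n (An n) (x n)].
Proof.
move=> AAn; split=> [[_ dA]|FA].
- apply: contrapT => /(proj2 (ultra_setC _)) FN.
  (* [W n] is the largest open subset of [Y n] that meets [An n] at most in [x n]. Gluing all [W n]
     at [xs] will give a neighbourhood of [xs] that misses [A] away from [xs]. *)
  pose G n := [set V | [/\ tau0 (S n) V, V `<=` Y n & V `&` (An n `\ x n) = set0]].
  pose W n := \bigcup_(V in G n) V.
  have tW n : tau0 (S n) (W n).
    by apply: (top_bigcup (bitop_tau0 (S_bitop n))) => V [].
  have WY n : W n `<=` Y n by move=> z [V [_ VY _]] /VY.
  pose U := \bigcup_n (W n `\ x n) `|` [set xs].
  have UB : U `<=` carrier B.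
    by move=> z [[n _ [/WY/Y_sub nz zx]]|->]; [exact: carrier_bouquet nz zx|right].
  have UW n z : Y n z -> z <> x n -> (U z <-> W n z).
    move=> Yz zx; split=> [[[m _ [Wz zxm]]|/=]|Wz]; last 1 first.
    - by left; exists n.
    - by rewrite -(index_inj (Y_sub _ _ (WY _ _ Wz)) (Y_sub _ _ Yz)).
    - by move/(carrier_neq_xs (Y_sub _ _ Yz)).
  have tU : tau0 B U.
    split=> // [n|_].
      rewrite (_ : _ `&` _ = W n `&` (Y n `\ x n)).
        by apply: (top_setI (bitop_tau0 (S_bitop n))).
      by apply/seteqP; split=> z [Uz [Yz zx]]; split=> //; exact/(UW n z Yz zx).
    (* When [x n] is not a limit point of [An n], a neighbourhood witnessing this, cut with [Y n],
       belongs to [G n]. Hence [x n] is in [W n], and the trace of [U] is the open set [W n]. *)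
    apply: filterS FN => n nd /=.
    rewrite (restr_eq (Y_sub n) (xY n) UB (WY n) _ (UW n)) //.
    split=> _; last by right.
    apply: contrapT => nW; apply: nd; split=> // V tV Vx.
    apply/set0P/eqP => V0; apply: nW; exists (V `&` Y n); last by split.
    split; [|by move=> z []|].
      by apply: (top_setI (bitop_tau0 (S_bitop n))).
    by apply/seteqP; split=> // z [[Vz _] Az]; rewrite -V0.
  have [w [Uw [Aw wxs]]] := dA U tU (or_intror erefl).
  case: Uw => [[n _ [Ww wx]]|//].
  have /AAn-/(_ wx)[/(_ Aw) Anw _] := WY _ _ Ww.
  by case: Ww => V [_ _ V0] Vw; rewrite -[False]/(set0 w) -V0; split.
- split=> [|U [UB _ /[swap] Uxs /(_ Uxs) FUY]]; first by right.
  (* A single index suffices: one where [x n] is a limit point and the trace of [U] is open. *)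
  have [n [[_ dn] tn]] := filter_ex (filterI FA FUY).
  have [w [rw [Aw wx]]] := dn _ tn (proj2 (restr_at (Y_sub n) (xY n) UB) Uxs).
  have Yw : Y n w by move: rw; rewrite /restr; case: ifP => _ [].
  exists w; split; first exact/(restr_off (Y_sub n) Yw wx).
  by split; [exact/(AAn n w Yw wx)|exact: carrier_neq_xs (Y_sub _ _ Yw)].
Qed.

Lemma los_derived {A : set T} {An : nat -> set T} :
  los A An -> los (dB A) (fun n => d n (An n)).
Proof. by case=> AAn _; split; [exact: derived_agree|exact: derived_xs]. Qed.

(** * The modality [Rhd]: restricting and gluing [tau1]-open sets *)

Lemma agree_restr {A U : set T} {An : nat -> set T} :
  agree A An ->
  agree (A `&` U) (fun n => An n `&` restr xs (x n) U (carrier (S n))).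
Proof.
move=> AAn n z Yz zx /=.
have := AAn n z Yz zx; have := restr_off (U := U) (fun _ h => h) (Y_sub _ _ Yz) zx.
by tauto.
Qed.

(* Whether the glued set contains [xs] must be decided uniformly in [n]. *)
Lemma bouquet_tau1_glue {N : set nat} {b : Prop} {Un : nat -> set T} :
  (forall n, N n -> tau1 (S n) (Un n)) ->
  (forall n, N n -> (Un n (x n) <-> b)) ->
  exists U, tau1 B U /\
    forall n, N n -> restr xs (x n) U (carrier (S n)) = Un n.
Proof.
move=> tUn xUn.
(* Outside [N] the piece is the whole carrier if [b] holds and empty otherwise: both are open and
   give the required answer at [x n]. *)
pose V n := [set z | (N n /\ Un n z) \/ (~ N n /\ b /\ carrier (S n) z)].
have VE n : N n -> V n = Un n.
  by move=> Nn; apply/seteqP; split=> z /=; rewrite /V /=; tauto.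
have tV n : tau1 (S n) (V n).
  have tn := bitop_tau1 (S_bitop n).
  have [Nn|Nn] := pselect (N n); first by rewrite VE //; exact: tUn.
  have [bT|bF] := pselect b.
    rewrite (_ : V n = carrier (S n)); first exact: top_setT tn.
    by apply/seteqP; split=> z /=; rewrite /V /=; tauto.
  rewrite (_ : V n = set0); first exact: top_set0 tn.
  by apply/seteqP; split=> z /=; rewrite /V /=; tauto.
have VS n : V n `<=` carrier (S n).
  exact: top_sub (bitop_tau1 (S_bitop n)) _ (tV n).
have Vx n : V n (x n) <-> b.
  by have := x_in n; have := xUn n; rewrite /V /=; have := pselect (N n); tauto.
pose U := \bigcup_n (V n `\ x n) `|` [set z | z = xs /\ b].
have UB : U `<=` carrier B.
  by move=> z [[n _ [/VS nz zx]]|[-> _]]; [exact: carrier_bouquet nz zx|right].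
have rU n : restr xs (x n) U (carrier (S n)) = V n.
  apply: restr_eq => // [|z nz zx].
    split=> [[[m _ [/VS /carrier_neq_xs]]//|[_ /Vx]]//|/Vx b1]; by right.
  split=> [[[m _ [Vz _]]|[]]|Vz].
  - by rewrite -(index_inj (VS _ _ Vz) nz).
  - by move/(carrier_neq_xs nz).
  - by left; exists n.
exists U; split=> [|n Nn]; last by rewrite rU VE.
by split=> // n; rewrite rU.
Qed.

Lemma rhd_agree {A C : set T} {An Cn : nat -> set T} :
  agree A An -> agree C Cn ->
  agree (rhd_op B A C) (fun n => rhd_op (S n) (An n) (Cn n)).
Proof.
move=> AAn CCn n z Yz zx; split=> -[_ AC].
- split=> [|U tU]; first exact: Y_sub.
  (* Only the summand [n] matters at [z], so [U] is extended by gluing over the single index [n],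
     with [b] dictated by [U] itself. *)
  have [||V [tV rV]] := @bouquet_tau1_glue [set n] (U (x n)) (fun=> U).
  + by move=> m ->.
  + by move=> m ->.
  move: (derived_agree (agree_restr (U := V) AAn) n z Yz zx).
  move: (derived_agree (agree_restr (U := V) CCn) n z Yz zx).
  by rewrite rV // => dC dA /dA/(AC V tV)/dC.
- split=> [|U [UB tU]]; first exact: carrier_bouquet (Y_sub _ _ Yz) zx.
  move=> /(derived_agree (agree_restr AAn) n z Yz zx) /AC.
  by move=> /(_ (tU n)) /(derived_agree (agree_restr CCn) n z Yz zx).
Qed.

Lemma rhd_xs {A C : set T} {An Cn : nat -> set T} :
  agree A An -> agree C Cn ->
  rhd_op B A C xs <-> F [set n | rhd_op (S n) (An n) (Cn n) (x n)].
Proof.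
move=> AAn CCn; split=> [[_ AC]|FAC].
- apply: contrapT => /(proj2 (ultra_setC _)) FN.
  (* If [Rhd] fails at [F]-almost all [x n], the refuting sets are chosen and glued into one
     [tau1]-open set refuting it at [xs]. *)
  pose bad n U := [/\ tau1 (S n) U, d n (An n `&` U) (x n)
                    & ~ d n (Cn n `&` U) (x n)].
  have {FN} FN : F [set n | exists U, bad n U].
    apply: filterS FN => n nAC; apply: contrapT => nbad.
    apply: nAC; split=> // U tU dA; apply: contrapT => ndC.
    by apply: nbad; exists U.
  have /choice[Un badU] : forall n, exists U, (exists U, bad n U) -> bad n U.
    (* [set0] is a dummy choice at indices without a refuting set. *)
    by move=> n; case: (pselect (exists U, bad n U)) => [[U]|nb]; [exists U|exists set0].
  (* The ultrafilter decides whether [x n] lies in the chosen set, giving the uniform answer that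
     gluing demands on a set of indices in [F]. *)
  have [b Fb] : exists b : Prop, F [set n | Un n (x n) <-> b].
    case: (in_ultra_setVsetC [set n | Un n (x n)] FU) => Fx.
      by exists True; apply: filterS Fx => n /=; tauto.
    by exists False; apply: filterS Fx => n /=; tauto.
  pose N := [set n | exists U, bad n U] `&` [set n | Un n (x n) <-> b].
  have FNb : F N by exact: filterI.
  have [||U [tU rU]] := @bouquet_tau1_glue N b Un.
  + by move=> n [/badU[]].
  + by move=> n [].
  have dC : dB (C `&` U) xs.
    apply: AC => //; apply/(derived_xs (agree_restr AAn)).
    by apply: filterS FNb => n Nn; rewrite /= rU //; case: (badU n (proj1 Nn)).
  have /(derived_xs (agree_restr CCn)) FC := dC.
  have [n [Nn dn]] := filter_ex (filterI FNb FC).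
  by case: (badU n (proj1 Nn)) => _ _; rewrite -(rU _ Nn).
- split=> [|U [UB tU]]; first by right.
  move=> /(derived_xs (agree_restr AAn)) FA.
  apply/(derived_xs (agree_restr CCn)).
  by apply: filterS (filterI FAC FA) => n [[_ AC] /AC]; exact.
Qed.

Lemma los_rhd {A C : set T} {An Cn : nat -> set T} :
  los A An -> los C Cn ->
  los (rhd_op B A C) (fun n => rhd_op (S n) (An n) (Cn n)).
Proof.
by case=> AAn _ [CCn _]; split; [exact: rhd_agree|exact: rhd_xs].
Qed.

(** * Boolean operations and the induction on formulas *)

Lemma los_compl {A : set T} {An : nat -> set T} :
  los A An -> los (carrier B `\` A) (fun n => carrier (S n) `\` An n).
Proof.
case=> AAn xsA; split=> [n z Yz zx|] /=.
  have := AAn n z Yz zx; have := Y_sub _ _ Yz.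
  by have := carrier_bouquet (Y_sub _ _ Yz) zx; rewrite /=; tauto.
rewrite (_ : [set n | _] = ~` [set n | An n (x n)]).
  by rewrite ultra_setC -xsA; split=> [[]//|]; split=> //; right.
by apply/seteqP; split=> n /=; have := x_in n; tauto.
Qed.

Lemma los_setI {A C : set T} {An Cn : nat -> set T} :
  los A An -> los C Cn -> los (A `&` C) (fun n => An n `&` Cn n).
Proof.
move=> [AAn xsA] [CCn xsC]; split=> [n z Yz zx|] /=.
  by have := AAn n z Yz zx; have := CCn n z Yz zx; tauto.
by rewrite (_ : [set n | _] = [set n | An n (x n)] `&` [set n | Cn n (x n)])//
  ultra_setI xsA xsC.
Qed.

Lemma los_setU {A C : set T} {An Cn : nat -> set T} :
  los A An -> los C Cn -> los (A `|` C) (fun n => An n `|` Cn n).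
Proof.
move=> [AAn xsA] [CCn xsC]; split=> [n z Yz zx|] /=.
  by have := AAn n z Yz zx; have := CCn n z Yz zx; tauto.
rewrite xsA xsC; split=> [[]|FAC]; first by apply: filterS => n; left.
  by apply: filterS => n; right.
(* If neither disjunct holds almost everywhere, both complements are in [F], and some index lies in
   them and in the set for the disjunction. *)
apply: contrapT => /not_orP[/(proj2 (ultra_setC _)) nA /(proj2 (ultra_setC _)) nC].
by have [n [[]]] := filter_ex (filterI FAC (filterI nA nC)) => ? [].
Qed.

Lemma los_carrier : los (carrier B) (fun n => carrier (S n)).
Proof.
split=> [n z Yz zx|].
  by split=> _; [exact: Y_sub|exact: carrier_bouquet (Y_sub _ _ Yz) zx].
by split=> _; [apply: filterS filterT => n _; exact: x_in|right].
Qed.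

Lemma los_set0 : los set0 (fun=> set0).
Proof. by split=> // ; split=> // /filter_ex[]. Qed.

Lemma los_restr {A : set T} : A `<=` carrier B ->
  los A (fun n => restr xs (x n) A (carrier (S n))).
Proof.
move=> AB; split=> [n z Yz zx|].
  by have := restr_off (U := A) (fun _ h => h) (Y_sub _ _ Yz) zx; tauto.
have rx n := restr_at (U := A) (fun _ h => h) (x_in n) AB.
split=> [xsA|/filter_ex[n /rx]//].
by apply: filterS filterT => n _; apply/rx.
Qed.

Lemma los_eval {v : formula -> set T} : is_valuation B v ->
  forall f, los (v f)
    (fun n => eval (S n) (fun i => restr xs (x n) (v (Var i)) (carrier (S n))) f).
Proof.
move=> vB; elim=> [i|||f IH|f IHf g IHg|f IHf g IHg|f IHf g IHg|f IH|f IH|f IHf g IHg].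
- rewrite (_ : (fun n => _) = fun n => restr xs (x n) (v (Var i)) (carrier (S n))).
    by apply: los_restr; exact: val_sub.
  by apply/funext => n /=; rewrite /restr; case: ifP => _; rewrite -setIA setIid.
- by rewrite (val_top vB); exact: los_carrier.
- by rewrite (val_bot vB); exact: los_set0.
- by rewrite (val_neg vB); exact: los_compl.
- by rewrite (val_and vB); exact: los_setI.
- by rewrite (val_or vB); exact: los_setU.
- by rewrite (val_imp vB); apply: los_setU => //; exact: los_compl.
(* [coderived] is complement, derived set, complement; the [try] lets the second round stop at the
   induction hypothesis. *)
- by rewrite (val_box vB); do 2![apply: los_compl; try apply: los_derived].
- by rewrite (val_dia vB); exact: los_derived.
- by rewrite (val_rhd vB); exact: los_rhd.
Qed.

(** * Points outside the sets [Y n] *)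

(** The singleton of [z] is open: its trace on every [Y m] is empty and it does not contain [xs]. *)
Lemma bouquet_isolated {n : nat} {z : T} :
  carrier (S n) z -> ~ Y n z -> isolated B z.
Proof.
move=> nz nYz.
have zB : carrier B z.
  by apply: (carrier_bouquet nz) => zx; apply: nYz; rewrite zx.
split=> // -[_ /(_ [set z])[||w [-> [_ /(_ erefl)]]]] //.
split=> [_ -> //|m|/esym/(carrier_neq_xs nz)] //.
rewrite (_ : _ `&` _ = set0); first by exact: top_set0 (bitop_tau0 (S_bitop m)).
apply/seteqP; split=> // _ [-> [Yz _]].
by apply: nYz; rewrite -(index_inj (Y_sub _ _ Yz) nz).
Qed.

End Ultrabouquet.

Theorem theorem4p12 (T : Type) (S : nat -> bispace T) (x : nat -> T)
    (Y : nat -> set T) (F : set (set nat)) (xs : T)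
    (S_bitop : forall n, is_bitopological (S n))
    (S_scattered : forall n, scattered (carrier (S n)) (tau0 (S n)))
    (S_disjoint : trivIset setT (fun n => carrier (S n)))
    (x_in : forall n, carrier (S n) (x n))
    (Y_sub : forall n, Y n `<=` carrier (S n))
    (xY : forall n, Y n (x n))
    (Y_open : forall n, tau0 (S n) (Y n))
    (Yx_open : forall n, tau0 (S n) (Y n `\ x n))
    (F_ultra : nonprincipal_ultrafilter F)
    (xs_new : ~ (\bigcup_n carrier (S n)) xs)
    (phi : formula) (phi_valid : forall n, valid (S n) phi) :
  valid (ultrabouquet S x Y F xs) phi.
Proof.
case: F_ultra => FU _ v vB.
apply/seteqP; split; first exact: val_sub.
have [vY vxs] := los_eval S_bitop S_disjoint x_in Y_sub xY Y_open Yx_open FU xs_new vB phi.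
have phiS n := phi_valid n _ (eval_valuation (S n)
  (fun i => restr xs (x n) (v (Var i)) (carrier (S n)))).
(* Points of [Y n] and the point [xs] are settled by the Łoś correspondence, points outside [Y n] by
   comparison with an isolated point of [S n]. *)
move=> z [[n _ [nz zx]]|->].
- have [Yz|nYz] := pselect (Y n z).
    by apply/(vY n z Yz zx); rewrite phiS.
  have [y yS] := scattered_isolated (bitop_nonempty (S_bitop n)) (S_scattered n).
  apply: (valid_isolated yS (phi_valid n) vB).
  exact: (bouquet_isolated S_bitop S_disjoint Y_sub xY xs_new nz nYz).
- apply/vxs; apply: filterS filterT => n _ /=.
  by rewrite phiS.
Qed.
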